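(* Let $n\ge1$. The poset $\mathcal X(\mathbf S^n,\mathbf S)_J$ consists of two parts: the base $Y^n=\{\Phi\in\mathcal X(\mathbf S^n,\mathbf S)_J\mid \Phi\le h\}$, which is an $n$-cube (i.e. is isomorphic as a poset to $2^n$, the $n$-th power of the two-element chain), and the hairs $\mathcal X(\mathbf S^n,\mathbf S)_J\setminus Y^n$, which are pairwise incomparable. Each element of the base is covered by a unique hair, and each hair covers a unique base element (covering being taken in the poset $\mathcal X(\mathbf S^n,\mathbf S)_J$).
   Context: $S=\{0,h,1\}$ is the chain $0<h<1$. Let $r_1=S^2\setminus\{(1,0)\}$, $r_2=S^2\setminus\{(h,0),(1,0)\}$, $r_3=S^2\setminus\{(0,1),(h,1),(1,0),(1,h)\}$, and $\mathbf S=\langle S;\{r_1,r_2,r_3\},\mathcal T\rangle$ with $\mathcal T$ discrete. $\mathcal X(\mathbf S^n,\mathbf S)$ is the set of maps $f:S^n\to S$ preserving $r_1,r_2,r_3$ (for each $k$: if $(x_i,y_i)\in r_k$ for all $i$, then $(f(x),f(y))\in r_k$), a lattice under the pointwise operations containing the constant maps $0,h,1$ (denoted by the same symbols). $\mathcal X(\mathbf S^n,\mathbf S)_J$ is its set of join-irreducible elements ($f\neq 0$, and $f=g\vee k$ with $g,k$ in the lattice implies $f=g$ or $f=k$), with the inherited pointwise partial order. *)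

(* Defs.v *)
From mathcomp Require Import all_boot all_order.
From mathcomp Require Import boolp classical_sets functions.
Set Implicit Arguments.
Unset Strict Implicit.
Unset Printing Implicit Defensive.
Import Order.TTheory.
Local Open Scope classical_set_scope.
Local Open Scope order_scope.

(* Sets and the pointwise order, meet and join on function
   types come from the classical layer of MathComp-Analysis. *)

Notation S3 := 'I_3.
Definition s0 : S3 := @Ordinal 3 0 isT.
Definition sh : S3 := @Ordinal 3 1 isT.
Definition s1 : S3 := @Ordinal 3 2 isT.

Definition r1 : set (S3 * S3) := setT `\` [set (s1, s0)].
Definition r2 : set (S3 * S3) := setT `\` [set (sh, s0); (s1, s0)].
Definition r3 : set (S3 * S3) :=
  setT `\` [set (s0, s1); (sh, s1); (s1, s0); (s1, sh)].

Definition preserves (n : nat) (r : set (S3 * S3)) (f : n.-tuple S3 -> S3) :=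
  forall x y : n.-tuple S3,
    (forall i : 'I_n, r (tnth x i, tnth y i)) -> r (f x, f y).

(* No continuity condition: the n-th power of the finite discrete space S3 is
   discrete, so every map is continuous. *)
Definition homs (n : nat) : set (n.-tuple S3 -> S3) :=
  [set f | [/\ preserves r1 f, preserves r2 f & preserves r3 f]].
Arguments homs n : clear implicits.

(* The ambient pointwise join is the join of the lattice [homs n], which is
   closed under it (see [homs_join]). *)
Definition homs_ji (n : nat) : set (n.-tuple S3 -> S3) :=
  [set f | [/\ homs n f, f <> (fun=> s0) &
    forall g k, homs n g -> homs n k -> f = (g `|` k)%O -> f = g \/ f = k]].
Arguments homs_ji n : clear implicits.

Definition base (n : nat) : set (n.-tuple S3 -> S3) :=
  [set f | homs_ji n f /\ f <= (fun=> sh)].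
Arguments base n : clear implicits.

Definition hairs (n : nat) : set (n.-tuple S3 -> S3) :=
  homs_ji n `\` base n.
Arguments hairs n : clear implicits.

(* [y] covers [x], in this order of arguments, in the subposet [A]. *)
Definition covers_in (d : Order.disp_t) (T : porderType d) (A : set T)
    (y x : T) : Prop :=
  [/\ A x, A y, x < y & ~ exists2 z, A z & x < z < y].

Lemma S3P (P : S3 -> Prop) : P s0 -> P sh -> P s1 -> forall c, P c.
Proof.
move=> P0 Ph P1; case=> -[|[|[|//]]] c.
- by rewrite (_ : Ordinal c = s0) //; apply: val_inj.
- by rewrite (_ : Ordinal c = sh) //; apply: val_inj.
- by rewrite (_ : Ordinal c = s1) //; apply: val_inj.
Qed.

Lemma r1E a b : r1 (a, b) <-> (a, b) \notin [:: (s1, s0)].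
Proof.
rewrite !inE; split=> [[_ /eqP]|/eqP ?]; first by [].
by split.
Qed.

Lemma r2E a b : r2 (a, b) <-> (a, b) \notin [:: (sh, s0); (s1, s0)].
Proof.
rewrite !inE; split=> [[_ H]|H].
  by apply/negP => /orP[]/eqP H'; apply: H; [left|right].
by split=> // H'; move: H; case: H' => ->; rewrite eqxx ?orbT.
Qed.

Lemma r3E a b :
  r3 (a, b) <-> (a, b) \notin [:: (s0, s1); (sh, s1); (s1, s0); (s1, sh)].
Proof.
rewrite !inE; split=> [[_ H]|H].
  by apply/negP => /or4P[]/eqP H'; apply: H; rewrite /setU /=; tauto.
by split=> // H'; move: H; case: H' => [[[]|]|] ->; rewrite eqxx ?orbT.
Qed.

Lemma homs_cst n (c : S3) : homs n (fun=> c).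
Proof.
by split=> x y _; [apply/r1E | apply/r2E | apply/r3E]; elim/S3P: c.
Qed.

Lemma homs_join n f g : homs n f -> homs n g -> homs n (f `|` g)%O.
Proof.
have E x : (f `|` g)%O x = f x `|` g x by [].
move=> [f1 f2 f3] [g1 g2 g3]; split=> x y xy; rewrite !E;
  [ move: (f1 _ _ xy) (g1 _ _ xy) => /r1E + /r1E + ; rewrite r1E
  | move: (f2 _ _ xy) (g2 _ _ xy) => /r2E + /r2E + ; rewrite r2E
  | move: (f3 _ _ xy) (g3 _ _ xy) => /r3E + /r3E + ; rewrite r3E ];
  by elim/S3P: (f x); elim/S3P: (f y); elim/S3P: (g x); elim/S3P: (g y).
Qed.

Lemma homs_meet n f g : homs n f -> homs n g -> homs n (f `&` g)%O.
Proof.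
have E x : (f `&` g)%O x = f x `&` g x by [].
move=> [f1 f2 f3] [g1 g2 g3]; split=> x y xy; rewrite !E;
  [ move: (f1 _ _ xy) (g1 _ _ xy) => /r1E + /r1E + ; rewrite r1E
  | move: (f2 _ _ xy) (g2 _ _ xy) => /r2E + /r2E + ; rewrite r2E
  | move: (f3 _ _ xy) (g3 _ _ xy) => /r3E + /r3E + ; rewrite r3E ];
  by elim/S3P: (f x); elim/S3P: (f y); elim/S3P: (g x); elim/S3P: (g y).
Qed.

(* Main.v *)
(* A map [f] preserves [r1], [r2], [r3] exactly when [h <= f x] is a monotone
   condition on the set [supp x] of coordinates with [h <= x i], [f x = 1] is
   an arbitrary condition on the set [ones x] of coordinates with [x i = 1],
   and the second condition on a set implies the first on its supersets.  So
   [f] amounts to a pair (A, B) with B an up-set of subsets of [n] and A any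
   family contained in B, and the join-irreducibles are the pairs
   (empty, up T), which form the base, and ({T}, up T), which are the hairs. *)
Require Import Defs.
From mathcomp Require Import all_boot all_order.
From mathcomp Require Import boolp classical_sets functions.
Set Implicit Arguments.
Unset Strict Implicit.
Unset Printing Implicit Defensive.
Import Order.TTheory.
Local Open Scope classical_set_scope.
Local Open Scope order_scope.

(** * The relations as implications between conditions on values *)

Lemma r1_leE a b : r1 (a, b) <-> (a = s1 -> sh <= b).
Proof.
rewrite r1E; split; elim/S3P: a; elim/S3P: b => //.
by move=> /(_ erefl).
Qed.

Lemma r2_leE a b : r2 (a, b) <-> (sh <= a -> sh <= b).
Proof.
by rewrite r2E; split; elim/S3P: a; elim/S3P: b => // /(_ isT).
Qed.

Lemma r3_eqE a b : r3 (a, b) <-> (a = s1 <-> b = s1).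
Proof.
by rewrite r3E; split; elim/S3P: a; elim/S3P: b => // -[H1 H2];
  first [by have := H1 erefl | by have := H2 erefl].
Qed.

Lemma sh_leE c : (sh <= c) = (c != s0).
Proof. by elim/S3P: c. Qed.

Lemma eq_sh c : c <= sh -> sh <= c -> c = sh.
Proof. by move=> c1 c2; apply/le_anti; rewrite c1. Qed.

Lemma s0_le c : s0 <= c.
Proof. by elim/S3P: c. Qed.

Lemma s1_leE c : (s1 <= c) = (c == s1).
Proof. by elim/S3P: c. Qed.

Lemma le_shE c : (c <= sh) = (c != s1).
Proof. by elim/S3P: c. Qed.

(** * Preservation in terms of sets of coordinates *)

Section Tuples.
Variable n : nat.
Implicit Types (x y : n.-tuple S3) (T : {set 'I_n}) (f g : n.-tuple S3 -> S3).

Definition supp x : {set 'I_n} := [set i | sh <= tnth x i]%SET.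
Definition ones x : {set 'I_n} := [set i | tnth x i == s1]%SET.

Lemma ones_supp x : ones x \subset supp x.
Proof. by apply/fintype.subsetP => i; rewrite !inE => /eqP ->. Qed.

Definition hchar T : n.-tuple S3 := [tuple if i \in T then sh else s0 | i < n].
Definition onechar T : n.-tuple S3 :=
  [tuple if i \in T then s1 else s0 | i < n].

Lemma supp_hchar T : supp (hchar T) = T.
Proof. by apply/setP => i; rewrite inE tnth_mktuple; case: (i \in T). Qed.

Lemma ones_onechar T : ones (onechar T) = T.
Proof. by apply/setP => i; rewrite inE tnth_mktuple; case: (i \in T). Qed.

Lemma homsP f : homs n f <->
  [/\ forall x y, ones x \subset supp y -> f x = s1 -> sh <= f y,
      forall x y, supp x \subset supp y -> sh <= f x -> sh <= f y &
      forall x y, ones x = ones y -> f x = s1 -> f y = s1].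
Proof.
split=> [[f1 f2 f3]|[f1 f2 f3]]; split=> x y xy.
- apply/r1_leE/f1 => i; apply/r1_leE => xi.
  by have /fintype.subsetP/(_ i) := xy; rewrite !inE xi; apply.
- apply/r2_leE/f2 => i; apply/r2_leE => xi.
  by have /fintype.subsetP/(_ i) := xy; rewrite !inE xi; apply.
- suff: r3 (f x, f y) by rewrite r3_eqE => -[].
  apply: f3 => i; rewrite r3_eqE.
  by have /setP/(_ i) := xy; rewrite !inE => E; split=> /eqP H; apply/eqP;
    rewrite ?E // -E.
- apply/r1_leE; apply: f1; apply/fintype.subsetP => i; rewrite !inE => /eqP.
  exact/r1_leE.
- apply/r2_leE; apply: f2; apply/fintype.subsetP => i; rewrite !inE.
  exact/r2_leE.
- have E : ones x = ones y.
    apply/setP => i; rewrite !inE.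
    by have := xy i; rewrite r3_eqE => -[H1 H2]; apply/eqP/eqP.
  by rewrite r3_eqE; split; exact: f3.
Qed.

(** * The two families of candidates and their minimality *)

Definition basef T : n.-tuple S3 -> S3 :=
  fun x => if T \subset supp x then sh else s0.

Definition hairf T : n.-tuple S3 -> S3 :=
  fun x => if ones x == T then s1 else basef T x.

Lemma sh_le_basef T x : (sh <= basef T x) = (T \subset supp x).
Proof. by rewrite /basef; case: ifP. Qed.

Lemma sh_le_hairf T x : (sh <= hairf T x) = (T \subset supp x).
Proof.
rewrite /hairf; case: eqP => [<-|_]; last exact: sh_le_basef.
by rewrite ones_supp.
Qed.

Lemma basef_neq1 T x : basef T x <> s1.
Proof. by rewrite /basef; case: ifP. Qed.

Lemma basef_le_sh T : basef T <= (fun=> sh).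
Proof. by apply/lefP => x; rewrite le_shE; apply/eqP/basef_neq1. Qed.

Lemma hairf_eq1 T x : hairf T x = s1 <-> ones x = T.
Proof.
by rewrite /hairf; case: eqP => // ?; split=> // /basef_neq1.
Qed.

Lemma homs_basef T : homs n (basef T).
Proof.
apply/homsP; split=> x y xy.
- by move/basef_neq1.
- by rewrite !sh_le_basef => /fintype.subset_trans; apply.
- by move/basef_neq1.
Qed.

Lemma homs_hairf T : homs n (hairf T).
Proof.
apply/homsP; split=> x y xy.
- by rewrite hairf_eq1 => xT; rewrite sh_le_hairf -xT.
- by rewrite !sh_le_hairf => /fintype.subset_trans; apply.
- by rewrite !hairf_eq1 xy.
Qed.

(** Since [supp (hchar T) = T], monotonicity carries the bound from [hchar T] to every [x] with
    [T \subset supp x]; elsewhere [basef T] is 0. *)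
Lemma basef_leP T g : homs n g -> reflect (basef T <= g) (sh <= g (hchar T)).
Proof.
move=> /homsP[_ g2 _]; apply: (iffP idP) => [gT|/lefP /(_ (hchar T))].
  apply/lefP => x; rewrite /basef; case: ifP => [Tx|_]; last exact: s0_le.
  by apply: g2 gT; rewrite supp_hchar.
by apply: le_trans; rewrite sh_le_basef supp_hchar.
Qed.

(** The value 1 at [onechar T] spreads to all [x] with [ones x = T] by the third condition of
    [homsP], and forces at least [h] where [T \subset supp x] by the first. *)
Lemma hairf_leP T g :
  homs n g -> reflect (hairf T <= g) (g (onechar T) == s1).
Proof.
move=> /homsP[g1 g2 g3]; rewrite -s1_leE.
apply: (iffP idP) => [|/lefP /(_ (onechar T))]; last first.
  by apply: le_trans; rewrite s1_leE; apply/eqP/hairf_eq1/ones_onechar.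
rewrite s1_leE => /eqP gT; apply/lefP => x; rewrite /hairf.
case: eqP => [xT|_]; first by rewrite (g3 _ _ _ gT) ?ones_onechar.
rewrite /basef; case: ifP => [Tx|_]; last exact: s0_le.
by apply: g1 gT; rewrite ones_onechar.
Qed.

(** In a chain, an element below a join is below one of the two terms, so [g] or [k] already reaches
    [f x] at [x], and minimality puts [f] below it. *)
Lemma least_homs_ji f x : homs n f -> f x <> s0 ->
  (forall g, homs n g -> f x <= g x -> f <= g) -> homs_ji n f.
Proof.
move=> hf fx0 fmin; split=> // [fE|g k hg hk fE]; first by rewrite fE in fx0.
have : f x <= g x `|` k x by rewrite fE.
by rewrite lexU => /orP[/(fmin _ hg) fg|/(fmin _ hk) fk]; [left|right];
  apply/le_anti; rewrite ?fg ?fk fE ?leUl ?leUr.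
Qed.

Lemma homs_ji_basef T : homs_ji n (basef T).
Proof.
have E : basef T (hchar T) = sh by rewrite /basef supp_hchar subxx.
apply: (@least_homs_ji _ (hchar T)); rewrite ?E //; first exact: homs_basef.
by move=> g hg /(basef_leP _ hg).
Qed.

Lemma homs_ji_hairf T : homs_ji n (hairf T).
Proof.
have E : hairf T (onechar T) = s1 by apply/hairf_eq1/ones_onechar.
apply: (@least_homs_ji _ (onechar T)); rewrite ?E //; first exact: homs_hairf.
by move=> g hg; rewrite s1_leE => /(hairf_leP _ hg).
Qed.

(* If [f <= h], then [f] is the join of [basef T] and of [f] lowered to 0 on
   [supp x = T], for [T] minimal among the sets [supp x] with [f x != 0]. *)
Lemma homs_ji_le_sh f :
  homs_ji n f -> f <= (fun=> sh) -> exists T, f = basef T.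
Proof.
move=> [/homsP[f1 f2 f3] f0 fji] /lefP fh.
have [x0 fx0] : exists x, sh <= f x.
  apply: contrapT => nf; apply: f0; apply/funext => x.
  by apply/eqP; apply: contra_notT nf => fx; exists x; rewrite sh_leE.
have [/= x {x0 fx0}fx xmin] :=
  @arg_minnP _ x0 (fun x => sh <= f x) (fun x => #|supp x|) fx0.
pose k y := if supp y == supp x then s0 else f y.
have hk : homs n k.
  apply/homsP; split=> y z yz; rewrite /k; case: (supp y =P supp x) => //.
  - by move=> _ fy; have := fh y; rewrite fy.
  - move=> yx fy; case: eqP => [zx|_]; last exact: f2 fy.
    (* Here [k z] is 0, but [supp y] would be a smaller competitor of the minimal [supp x]. *)
    have : supp y \proper supp x.
      by rewrite -zx in yx *; rewrite finset.properEneq yz andbT; apply/eqP.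
    by move/proper_card; rewrite ltnNge xmin.
  - by move=> _ fy; have := fh y; rewrite fy.
exists (supp x).
have fE : f = basef (supp x) `|` k.
  apply/funext => y; apply/eqP.
  change (f y == basef (supp x) y `|` k y); rewrite /k /basef.
  case: (supp y =P supp x) => [yx|_].
    have fy : sh <= f y by apply: f2 fx; rewrite yx.
    by rewrite yx subxx (eq_sh (fh y) fy).
  case: ifP => [xy|_]; last by elim/S3P: (f y).
  by have := f2 _ _ xy fx; have := fh y; elim/S3P: (f y).
have [//|kE] := fji _ _ (homs_basef _) hk fE.
by move: fx; rewrite kE /k eqxx.
Qed.

(* Here [f] is the join of [hairf (ones x)] and of [f] lowered to [h] at the
   points with the same [ones] as [x], for any [x] with [f x = 1]. *)
Lemma homs_ji_eq1 f x : homs_ji n f -> f x = s1 -> f = hairf (ones x).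
Proof.
move=> [hf _ fji] fx; have /homsP[f1 f2 f3] := hf.
pose k y := if ones y == ones x then sh else f y.
(* Since [f] is 1 wherever [ones y = ones x], lowering it to [h] there does not change where the
   value is at least [h]. *)
have kge y : (sh <= k y) = (sh <= f y).
  by rewrite /k; case: eqP => // yx; rewrite (f3 x).
have hk : homs n k.
  apply/homsP; split=> y z yz; rewrite ?kge.
  - by rewrite /k; case: eqP => // _; exact: f1.
  - exact: f2.
  - by rewrite /k yz; case: eqP => // _; exact: f3.
have fE : f = hairf (ones x) `|` k.
  apply/funext => y; apply/eqP.
  change (f y == hairf (ones x) y `|` k y); rewrite /k /hairf.
  case: (ones y =P ones x) => [yx|_]; first by rewrite (f3 x).
  rewrite /basef; case: ifP => [xy|_]; last by elim/S3P: (f y).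
  by have := f1 _ _ xy fx; elim/S3P: (f y).
have [//|kE] := fji _ _ (homs_hairf _) hk fE.
by move: fx; rewrite kE /k eqxx.
Qed.

Lemma baseE : base n = range basef.
Proof.
apply/seteqP; split=> [f [fji /(homs_ji_le_sh fji)[T ->]]|_ [T _ <-]].
  by exists T.
by split; [exact: homs_ji_basef|exact: basef_le_sh].
Qed.

Lemma hairsE : hairs n = range hairf.
Proof.
apply/seteqP; split=> [f [fji nfb]|_ [T _ <-]].
  have [x fx] : exists x, f x = s1.
    apply: contrapT => nf; apply: nfb; split=> //; apply/lefP => x.
    by rewrite le_shE; apply/eqP => fx; apply: nf; exists x.
  by exists (ones x); rewrite -?(homs_ji_eq1 fji fx).
split; first exact: homs_ji_hairf.
move=> [_ /lefP /(_ (onechar T))].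
by rewrite (hairf_eq1 _ _).2 // ones_onechar.
Qed.

Lemma homs_ji_cases f :
  homs_ji n f -> (exists T, f = basef T) \/ (exists T, f = hairf T).
Proof.
move=> fji; have [fb|nfb] := pselect (base n f).
  by left; move: fb; rewrite baseE => -[T _ <-]; exists T.
have : hairs n f by split.
by rewrite hairsE => -[T _ <-]; right; exists T.
Qed.

(** * Order and covering between the two families *)

Lemma le_basef T T' : (basef T <= basef T') = (T' \subset T).
Proof.
rewrite -[in RHS](supp_hchar T) -sh_le_basef.
exact/idP/(basef_leP _ (homs_basef T')).
Qed.

Lemma le_basef_hairf T T' : (basef T <= hairf T') = (T' \subset T).
Proof.
rewrite -[in RHS](supp_hchar T) -sh_le_hairf.
exact/idP/(basef_leP _ (homs_hairf T')).
Qed.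

Lemma le_hairf T T' : (hairf T <= hairf T') = (T == T').
Proof.
by apply/idP/eqP => [/(hairf_leP _ (homs_hairf T'))/eqP|<-//];
  rewrite hairf_eq1 ones_onechar.
Qed.

Lemma le_hairf_basef T T' : (hairf T <= basef T') = false.
Proof. by apply/negP => /(hairf_leP _ (homs_basef T'))/eqP/basef_neq1. Qed.

Lemma covers_hairf_basef T T' :
  covers_in (homs_ji n) (hairf T') (basef T) <-> T = T'.
Proof.
split=> [[_ _ /ltW + nobetween]|<-]; last first.
  split; [exact: homs_ji_basef|exact: homs_ji_hairf| |].
    by rewrite lt_leAnge le_basef_hairf le_hairf_basef subxx.
  (* An intermediate [basef S] would need [T \subset S] with [S] proper in [T]; a hair below
     [hairf T] equals it. *)
  move=> [z /homs_ji_cases[] [S ->]]; rewrite !lt_leAnge.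
    rewrite !le_basef le_basef_hairf => /andP[/andP[_ nTS] /andP[TS _]].
    by rewrite TS in nTS.
  by rewrite !le_hairf eq_sym => /andP[_ /andP[->]].
rewrite le_basef_hairf => T'T; apply/eqP; apply: contra_notT nobetween => TT'.
(* When [T'] is a proper subset of [T], [basef T'] lies strictly between. *)
exists (basef T'); first exact: homs_ji_basef.
rewrite !lt_leAnge !le_basef le_basef_hairf le_hairf_basef T'T subxx andbT /=.
by apply: contra TT' => TT'; rewrite finset.eqEsubset TT'.
Qed.

End Tuples.

Theorem theorem3 (n : nat) (hn : (1 <= n)%N) :
  [/\
      exists phi : n.-tupleprod bool -> (n.-tuple S3 -> S3),
        set_bij setT (base n) phi /\ {mono phi : a b / a <= b},
      forall u v : n.-tuple S3 -> S3,
        hairs n u -> hairs n v -> u <> v -> u >< v,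
      forall b : n.-tuple S3 -> S3, base n b ->
        exists! u, hairs n u /\ covers_in (homs_ji n) u b
    & forall u : n.-tuple S3 -> S3, hairs n u ->
        exists! b, base n b /\ covers_in (homs_ji n) u b].
Proof.
rewrite baseE hairsE; split.
(* [basef] reverses inclusion, so taking the set of false coordinates makes the map increasing. *)
- pose zeros (a : n.-tupleprod bool) : {set 'I_n} :=
    [set i | ~~ tnth a i]%SET.
  exists (fun a => basef (zeros a)).
  have mono : {mono (fun a => basef (zeros a)) : a b / a <= b}.
    move=> a b; rewrite le_basef leEtprod.
    apply/fintype.subsetP/forallP => ab i; have := ab i; rewrite ?inE.
      by case: (tnth a i); case: (tnth b i) => // /(_ isT).
    by case: (tnth a i); case: (tnth b i).
  split=> //; split.
  + by move=> a _; exists (zeros a).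
  + by move=> a b _ _; exact: (inc_inj mono).
  + move=> _ [T _ <-]; exists [tuple i \notin T | i < n] => //.
    congr basef; apply/setP => i.
    by rewrite inE tnth_mktuple negbK.
- move=> _ _ [T _ <-] [T' _ <-] TT'; rewrite /Order.comparable !le_hairf.
  by rewrite eq_sym orbb; apply/eqP => E; apply: TT'; rewrite E.
(* Covering matches [basef T] with [hairf T] only, which gives existence and uniqueness here and in
   the last claim. *)
- move=> _ [T _ <-]; exists (hairf T); split.
    by split; [exists T|exact/covers_hairf_basef].
  by move=> _ [[T' _ <-] /covers_hairf_basef ->].
- move=> _ [T _ <-]; exists (basef T); split.
    by split; [exists T|exact/covers_hairf_basef].
  by move=> _ [[T' _ <-] /covers_hairf_basef ->].
Qed.
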